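(* The class of all finite semigeneric tournaments has EPPA (the extension property for partial automorphisms).
   Context: A directed graph is a structure with one binary relation which is irreflexive and antisymmetric (no loops, no bi-directional edges). Substructures are induced, and embeddings are injective maps preserving the relation in both directions. A directed graph $\mathbf A$ is an $\omega$-partite tournament if its vertex set can be partitioned into countably many (possibly empty) pairwise disjoint sets $A_1,A_2,\ldots$, called parts, such that every pair of vertices in different parts is connected by a directed edge (in exactly one direction) and there are no edges between vertices in the same part. The parts are not named by the language. An $\omega$-partite tournament $\mathbf A$ is semigeneric if for every pair of parts $X$ and $Y$ of $\mathbf A$, and every $a\neq b\in X$ and $c\neq d\in Y$, the number of edges directed from $\{a,b\}$ to $\{c,d\}$ is even. A class $\mathcal C$ of structures has EPPA if for every $\mathbf A\in\mathcal C$ there exists $\mathbf B\in\mathcal C$ containing $\mathbf A$ as a substructure such that every isomorphism between two substructures of $\mathbf A$ (a partial automorphism of $\mathbf A$) extends to an automorphism of $\mathbf B$. *)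

(* Defs.v *)
From HB Require Import structures.
From mathcomp Require Import all_boot.

Set Implicit Arguments.
Unset Strict Implicit.
Unset Printing Implicit Defensive.

Record fin_digraph := FinDigraph {
  vertex :> finType;
  edge : rel vertex;
  edge_irrefl : irreflexive edge;
  edge_antisym : antisymmetric edge
}.

Definition embedding (A B : fin_digraph) (f : A -> B) : Prop :=
  injective f /\ forall x y : A, edge (f x) (f y) = edge x y.

Definition isomorphism (A B : fin_digraph) (f : A -> B) : Prop :=
  embedding f /\ bijective f.

Section Induced.

Variables (A : fin_digraph) (D : {set A}).

Definition induced_edge : rel {x : A | x \in D} :=
  fun u v => edge (val u) (val v).

Lemma induced_edge_irrefl : irreflexive induced_edge.
Proof. by move=> u; apply: edge_irrefl. Qed.

Lemma induced_edge_antisym : antisymmetric induced_edge.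
Proof. by move=> u v uv; apply/val_inj/edge_antisym. Qed.

Definition induced : fin_digraph :=
  FinDigraph induced_edge_irrefl induced_edge_antisym.

End Induced.

(* The partition is coded by a labelling [p]: the i-th part is the set of     *)
(* vertices with label i, so a part is empty when its label is not used.      *)
Definition partite_tournament (A : fin_digraph) (p : A -> nat) : Prop :=
  (forall x y : A, p x = p y -> ~~ edge x y) /\
  (forall x y : A, p x <> p y -> edge x y (+) edge y x).

Definition edges_from_to (A : fin_digraph) (X Y : {set A}) : {set A * A} :=
  [set xy in setX X Y | edge xy.1 xy.2].

(* The parts are not part of the structure, hence the existential. Apart from *)
(* its labels [p] is determined by [A]: two vertices lie in the same part iff *)
(* there is no edge between them.                                             *)
Definition semigeneric_tournament (A : fin_digraph) : Prop :=
  exists p : A -> nat,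
    partite_tournament p /\
    forall a b c d : A, p a = p b -> a <> b -> p c = p d -> c <> d ->
      ~~ odd #|edges_from_to [set a; b] [set c; d]|.

(* Containment of A in B as a substructure is expressed by an embedding i.    *)
Definition EPPA (C : fin_digraph -> Prop) : Prop :=
  forall A : fin_digraph, C A ->
    exists (B : fin_digraph) (i : A -> B),
      [/\ C B,
          embedding i
        & forall (D R : {set A}) (f : induced D -> induced R),
            isomorphism f ->
            exists g : B -> B,
              isomorphism g /\
              forall x : induced D, g (i (val x)) = i (val (f x))].

(* Main.v *)
Require Import Defs.
From mathcomp Require Import all_boot all_fingroup.

(** A semigeneric tournament is a family of parts where each vertex [x] has a
bit towards every other part: the edge between [x] and [y] is the sum of the
bit of [x] towards the part of [y], the bit of [y] towards the part of [x] and
an orientation of the pair of parts.  The extension has as parts all functions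
[A -> bool], tagged by representatives of the parts of [A], and as vertices of
a part all functions from the set of parts to [bool].  The part of [y] is sent
to the function [xi y] of bits towards it, and the vertex [x] to evaluation at
[x].  A partial automorphism is first extended to a permutation of the parts
which respects, for any two vertices [x], [x'] of the domain in one part,
whether they have equal bits; the bits are then corrected by a quantity which
depends on the pair of parts only, and such corrections are automorphisms. *)

Set Implicit Arguments.
Unset Strict Implicit.
Unset Printing Implicit Defensive.

(* Correct [p0] by one transposition for each index; [E] is only ever used
between the two points that a transposition exchanges. *)
Lemma extend_to_perm (I : eqType) (T : finType) (s : seq I) (a b : I -> T)
    (E : T -> T -> Prop) (p0 : {perm T}) :
  (forall x, E x x) -> (forall x y, E x y -> E y x) ->
  (forall x y z, E x y -> E y z -> E x z) ->
  (forall i j, (a i == a j) = (b i == b j)) ->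
  (forall i, E (p0 (a i)) (b i)) ->
  exists p : {perm T},
    {in s, forall i, p (a i) = b i} /\ forall x, E (p x) (p0 x).
Proof.
move=> Er Es Et ab p0E; elim: s => [|i s [p [ps pE]]].
  by exists p0; split.
exists (p * tperm (p (a i)) (b i))%g; split=> [j|x].
  rewrite inE permM => /orP[/eqP->|js]; first by rewrite tpermL.
  have [aij|aij] := eqVneq (a i) (a j).
    by rewrite aij tpermL; apply/eqP; rewrite -ab aij.
  rewrite tpermD ?(inj_eq perm_inj) //; first exact: ps.
  by rewrite (ps j js) -ab.
rewrite permM; case: tpermP => [/perm_inj->|px|_ _]; last exact: pE.
- exact/Es/p0E.
- by apply: (Et _ _ _ (pE _)); apply: (Et _ _ _ (p0E i)); rewrite -px.
Qed.

(** * Orientations and parities of edges *)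

Definition skew (T : eqType) (o : rel T) :=
  forall x y, x != y -> o x y (+) o y x.

Definition precedes (T : finType) : rel T :=
  fun x y => enum_rank x < enum_rank y.

Lemma precedes_skew (T : finType) : skew (@precedes T).
Proof.
move=> x y; rewrite /precedes -(inj_eq enum_rank_inj) -(inj_eq val_inj) /=.
by case: ltngtP.
Qed.

Lemma odd_edges_from_to (A : fin_digraph) (a b c d : A) : a != b -> c != d ->
  odd #|edges_from_to [set a; b] [set c; d]| =
    edge a c (+) edge a d (+) (edge b c (+) edge b d).
Proof.
move=> ab cd; rewrite /edges_from_to -sum1_card.
rewrite (eq_bigl (fun xy : A * A => ((xy.1 \in [set a; b]) &&
  (xy.2 \in [set c; d])) && edge xy.1 xy.2)); last by move=> xy; rewrite !inE.
rewrite big_mkcondr -(pair_big (mem [set a; b]) (mem [set c; d])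
  (fun x y => if edge x y then 1 else 0)) /=.
rewrite !(big_setU1, big_set1) ?inE //= !oddD.
by do 4!case: edge.
Qed.

(** * Tournaments given by bits and an orientation *)

Section Switching.

Variables (L : finType) (o : rel L).
Hypothesis o_skew : skew o.

Definition switch_vertex : finType := (L * {ffun L -> bool})%type.

Definition switch_edge : rel switch_vertex :=
  fun u v => (u.1 != v.1) && (u.2 v.1 (+) v.2 u.1 (+) o u.1 v.1).

Lemma switch_edge_irrefl : irreflexive switch_edge.
Proof. by move=> u; rewrite /switch_edge eqxx. Qed.

Lemma switch_edge_addb u v : u.1 != v.1 -> switch_edge u v (+) switch_edge v u.
Proof.
move=> uv; rewrite /switch_edge uv eq_sym uv /=.
by have := o_skew uv; case: (u.2 _); case: (v.2 _); do 2!case: (o _ _).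
Qed.

Lemma switch_edge_antisym : antisymmetric switch_edge.
Proof.
move=> u v /andP[uv vu]; case/andP: (uv) => /switch_edge_addb.
by rewrite uv vu.
Qed.

Definition switch_digraph : fin_digraph :=
  FinDigraph switch_edge_irrefl switch_edge_antisym.

(** In the sum of the four edges between two pairs, each bit occurs twice and the orientation four
    times. *)
Lemma switch_semigeneric : semigeneric_tournament switch_digraph.
Proof.
have inj (u v : switch_digraph) :
    enum_rank u.1 = enum_rank v.1 :> nat -> u.1 = v.1.
  by move=> /val_inj/enum_rank_inj.
exists (fun u : switch_digraph => enum_rank u.1 : nat); split; first split.
- by move=> u v /inj uv; rewrite /edge /= /switch_edge uv eqxx.
- by move=> u v uv; apply: switch_edge_addb; apply: contra_not_neq uv => ->.
move=> a b c d /inj ab /eqP a_b /inj cd /eqP c_d.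
rewrite odd_edges_from_to //= /switch_edge ab cd.
case: eqP => //= _.
by case: (a.2 _); case: (b.2 _); case: (c.2 _); case: (d.2 _); case: (o _ _).
Qed.

(** [H P Q] is added to the bit towards [Q] of every vertex of part [P]; the two corrections for a
    pair together undo the change of orientation made by [pi]. *)
Lemma switch_automorphism (pi : {perm L}) (H : L -> L -> bool) :
  (forall P Q, P != Q -> H P Q (+) H Q P = o P Q (+) o (pi P) (pi Q)) ->
  isomorphism (A := switch_digraph) (B := switch_digraph)
    (fun u => (pi u.1, [ffun Q =>
      u.2 ((pi^-1)%g Q) (+) H u.1 ((pi^-1)%g Q)])).
Proof.
move=> Ho; set g := (X in isomorphism X).
have g_inj : injective g.
  move=> [P chi] [Q psi] [/perm_inj PQ /ffunP e]; rewrite -{Q}PQ in e *.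
  congr (_, _); apply/ffunP => Q; have := e (pi Q).
  by rewrite !ffunE permK => /addIb.
split; last exact: injF_bij.
split=> // -[P chi] [Q psi].
rewrite /g /edge /= /switch_edge /= (inj_eq perm_inj) !ffunE !permK.
case: eqVneq => //= /Ho; case: (chi Q); case: (psi P).
all: by do 2!case: (H _ _); do 2!case: (o _ _).
Qed.

End Switching.

Lemma semigeneric_coordinates (A : fin_digraph) :
  semigeneric_tournament A ->
  exists (r : A -> A) (xi : A -> {ffun A -> bool}),
  [/\ forall x y, r x = r y -> ~~ edge x y,
      forall x y, r x = r y -> xi x = xi y,
      forall x y, r x = r y -> ~~ xi y x
    & forall x y, r x != r y ->
        edge x y = xi y x (+) xi x y (+) precedes (r x) (r y)].
Proof.
case=> p [[p0 p1] p2].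
have even a b c d : p a = p b -> p c = p d ->
    edge a c (+) edge a d (+) (edge b c (+) edge b d) = false.
  move=> ab cd; have [->|a_b] := eqVneq a b; first exact: addbb.
  have [->|c_d] := eqVneq c d; first by rewrite !addbb.
  rewrite -odd_edges_from_to //; apply/negbTE/p2 => //; exact/eqP.
(* The choice depends on [p x] only and succeeds, as [x] itself qualifies, so [r] is constant on
   parts. *)
pose r x := odflt x [pick z | p z == p x].
have pr x : p (r x) = p x.
  by rewrite /r; case: pickP => [z /eqP|].
have rE x y : (r x == r y) = (p x == p y).
  apply/eqP/eqP => [rxy|pxy]; first by rewrite -pr rxy pr.
  rewrite /r pxy; case: pickP => //= /(_ y); by rewrite eqxx.
(* Evenness gives [edge x y] as the sum of [edge x (r y)], [edge (r x) y] and [edge (r x) (r y)].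
   The first term goes to the bit of [x], the others to that of [y]; the negation cancels
   [precedes]. *)
exists r, (fun y => [ffun x => (r x != r y) &&
  (if precedes (r x) (r y) then ~~ edge x (r y)
   else edge (r y) x (+) edge (r y) (r x))]); split.
- by move=> x y /eqP; rewrite rE => /eqP/p0.
- by move=> x y rxy; apply/ffunP => z; rewrite !ffunE rxy.
- by move=> x y rxy; rewrite ffunE rxy eqxx.
move=> x y rxy; rewrite !ffunE rxy eq_sym rxy /=.
have := precedes_skew rxy.
have pxy : p x <> p y by apply/eqP; rewrite -rE.
have := p1 _ _ pxy.
have := even x (r x) y (r y) (esym (pr x)) (esym (pr y)).
have := even y (r y) x (r x) (esym (pr y)) (esym (pr x)).
by case: precedes; case: precedes => //; do 8!case: edge.
Qed.

(** * Embedding into the extension *)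

Section PartialAutomorphism.

Variables (A : fin_digraph) (r : A -> A) (xi : A -> {ffun A -> bool}).
Hypothesis part_noedge : forall x y, r x = r y -> ~~ edge x y.
Hypothesis part_xi : forall x y, r x = r y -> xi x = xi y.
Hypothesis part_xi0 : forall x y, r x = r y -> ~~ xi y x.
Hypothesis edge_xi : forall x y, r x != r y ->
  edge x y = xi y x (+) xi x y (+) precedes (r x) (r y).

Definition label : finType := (A * {ffun A -> bool})%type.

(** Representatives are compared first, so that distinct parts of [A] keep the orientation used in
    [edge_xi]. *)
Definition label_prec : rel label := fun P Q =>
  if P.1 == Q.1 then precedes P.2 Q.2 else precedes P.1 Q.1.

Lemma label_prec_skew : skew label_prec.
Proof.
move=> [x P] [y Q]; rewrite /label_prec xpair_eqE /= [y == x]eq_sym.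
by case: eqVneq => [_|xy _] /=; [exact: precedes_skew|exact: precedes_skew].
Qed.

Definition part_label (x : A) : label := (r x, xi x).

Lemma part_labelE x y : (part_label x == part_label y) = (r x == r y).
Proof.
rewrite xpair_eqE; case: eqVneq => //= rxy.
exact/eqP/part_xi.
Qed.

(** Being in one part is visible from the edges, hence preserved by partial automorphisms. *)
Lemma part_label_edge x y :
  (part_label x == part_label y) = ~~ (edge x y || edge y x).
Proof.
rewrite part_labelE; case: eqVneq => [rxy|rxy].
  by rewrite !(negbTE (part_noedge _)).
have ryx : r y != r x by rewrite eq_sym.
have := precedes_skew rxy; rewrite (edge_xi rxy) (edge_xi ryx).
by case: (xi x y); case: (xi y x); case: precedes; case: precedes.
Qed.

Local Notation B := (switch_digraph label_prec_skew).

Definition switch_embed (x : A) : B := (part_label x, [ffun Q : label => Q.2 x]).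

Lemma switch_embedP : embedding switch_embed.
Proof.
(* Evaluation at the indicator function of [x] separates [x] from all other vertices. *)
split=> [x y [_ _ /ffunP/(_ (x, [ffun z => z == x]))]|x y].
  by rewrite !ffunE eqxx => /esym/eqP.
rewrite -[LHS]/(switch_edge label_prec (switch_embed x) (switch_embed y)).
rewrite /switch_edge part_labelE /= !ffunE /=.
case: eqVneq => [/part_noedge/negbTE //|rxy] /=.
by rewrite (edge_xi rxy) /label_prec /= (negbTE rxy).
Qed.

(** * Extending the partial automorphism that sends [a u] to [b u] *)

Variables (J : finType) (a b : J -> A).
Hypothesis a_inj : injective a.
Hypothesis b_inj : injective b.
Hypothesis ab_edge : forall u v, edge (b u) (b v) = edge (a u) (a v).

Lemma ab_label u v : (part_label (a u) == part_label (a v)) =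
  (part_label (b u) == part_label (b v)).
Proof. by rewrite !part_label_edge !ab_edge. Qed.

(** The second conclusion says that the change of the bit towards [Q] is the same for all domain
    vertices of a part, so that one correction serves them all. *)
Lemma label_perm : exists pi : {perm label},
  (forall u, pi (part_label (a u)) = part_label (b u)) /\
  forall u v (Q : label), part_label (a u) = part_label (a v) ->
    Q.2 (a u) (+) (pi Q).2 (b u) = Q.2 (a v) (+) (pi Q).2 (b v).
Proof.
have [fh [fhE _]] : exists p : {perm A},
    {in enum J, forall u, p (a u) = b u} /\ (A -> True).
  apply: (@extend_to_perm _ _ _ _ _ (fun _ _ => True) 1%g) => // u v.
  by rewrite (inj_eq a_inj) (inj_eq b_inj).
have fhV u : (fh^-1)%g (b u) = a u by rewrite -fhE ?mem_enum // permK.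
(* Transport along [fh] changes no bit of a domain vertex but may misplace the labels of parts;
   replacing values by [E]-related ones repairs this and keeps the second conclusion. *)
pose pi0f (Q : label) : label := (Q.1, [ffun x => Q.2 ((fh^-1)%g x)]).
have pi0_inj : injective pi0f.
  move=> [x P] [y Q] [-> /ffunP e]; congr (_, _); apply/ffunP => z.
  by have := e (fh z); rewrite !ffunE permK.
pose E (P Q : label) := forall u v, part_label (a u) = part_label (a v) ->
  P.2 (b u) (+) P.2 (b v) = Q.2 (b u) (+) Q.2 (b v).
have [||||w|pi [piE piT]] := @extend_to_perm _ _ (enum J)
  (fun u => part_label (a u)) (fun u => part_label (b u)) E (perm pi0_inj).
- by [].
- by move=> P Q PQ u v uv; rewrite PQ.
- by move=> P Q S PQ QS u v uv; rewrite PQ // QS.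
- exact: ab_label.
(* For [a u] and [a v] in one part, the bits towards the part of [a w] differ exactly when the edges
   to [a w] do, and edges are preserved. *)
- move=> u v uv; rewrite permE !ffunE !fhV /=.
  have ruv : r (a u) = r (a v) by case: uv.
  have buv : part_label (b u) = part_label (b v).
    by apply/eqP; rewrite -ab_label uv.
  have rbuv : r (b u) = r (b v) by case: buv.
  have := ab_label u w; rewrite !part_labelE.
  case: (eqVneq (r (a u))) => [e /esym/eqP e'|e /esym/negbT e'].
    rewrite !(negbTE (part_xi0 _)) //; congruence.
  have := ab_edge u w; have := ab_edge v w.
  rewrite !edge_xi -?ruv -?rbuv // (part_xi ruv) (part_xi rbuv).
  by do 2!case: precedes; do 6!case: (xi _ _).
exists pi; split=> [u|u v Q uv]; first by rewrite piE ?mem_enum.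
have := piT Q u v uv; rewrite permE !ffunE !fhV /=.
by do 2!case: (Q.2 _); do 2!case: ((pi Q).2 _).
Qed.

Lemma switch_extension : exists g : B -> B,
  isomorphism g /\ forall u, g (switch_embed (a u)) = switch_embed (b u).
Proof.
have [pi [piE piQ]] := label_perm.
pose at_label P := [pick u | part_label (a u) == P].
pose s P Q := label_prec P Q (+) label_prec (pi P) (pi Q).
pose K u (Q : label) := Q.2 (a u) (+) (pi Q).2 (b u).
(* If [P] meets the domain, the correction is forced by a vertex there. If only [Q] does, it is
   solved from [H P Q (+) H Q P = s P Q]. Otherwise [s P Q] is charged to one side, chosen by
   [label_prec]. *)
pose H P Q :=
  if at_label P is Some u then K u Q
  else if at_label Q is Some v then K v P (+) s P Q
  else label_prec P Q && s P Q.
have sC P Q : P != Q -> s P Q = s Q P.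
  move=> PQ; have piPQ : pi P != pi Q by rewrite (inj_eq perm_inj).
  have := label_prec_skew PQ; have := label_prec_skew piPQ.
  by rewrite /s; do 4!case: label_prec.
eexists; split.
  apply: (@switch_automorphism _ _ label_prec_skew pi H) => P Q PQ.
  rewrite -/(s P Q) /H /at_label.
  case: pickP => [u /eqP uP|_]; case: pickP => [v /eqP vQ|_].
  (* Both corrections are forced here; they fit because the edge from [a u] to [a v] is
     preserved. *)
  - rewrite -uP -vQ /K /s !piE /=.
    have e : r (a u) != r (a v) by rewrite -part_labelE uP vQ.
    have e' : r (b u) != r (b v) by rewrite -part_labelE -ab_label uP vQ.
    have := ab_edge u v; rewrite !edge_xi // /label_prec /= !ifN //.
    by do 2!case: precedes; do 4!case: (xi _ _).
  - by rewrite (sC Q P) 1?eq_sym // addbA addbb.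
  - by rewrite addbAC addbb.
  - rewrite (sC Q P) 1?eq_sym //; have := label_prec_skew PQ.
    by case: (s P Q); do 2!case: label_prec.
move=> u; rewrite /switch_embed /= piE; congr (_, _); apply/ffunP => Q.
rewrite !ffunE /H /at_label; case: pickP => [v /eqP vu|/(_ u)]; last by rewrite eqxx.
by rewrite /K (piQ v u) // permKV addbA addbb.
Qed.

End PartialAutomorphism.

Theorem theorem1p2 : EPPA semigeneric_tournament.
Proof.
move=> A /semigeneric_coordinates[r [xi [r0 rxi rxi0 xiE]]].
exists (switch_digraph (@label_prec_skew A)), (switch_embed r xi); split.
- exact: switch_semigeneric.
- exact: switch_embedP.
move=> D R f [[f_inj f_edge] _].
apply: (switch_extension r0 rxi rxi0 xiE val_inj (inj_comp val_inj f_inj)).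
exact: f_edge.
Qed.
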